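(* For all $n\ge 1$, the polynomial $W_n(q,t):=\sum_{\sigma\in\mathcal{W}^*_{2n+1}} q^{\mathrm{art}(\sigma)} t^{\mathrm{des}(\sigma)}$ can be expanded as \[ W_n(q,t)=\sum_{j=0}^{\lfloor n/2\rfloor} \gamma_{n,j}(q)\, t^j(1+t)^{n-2j},\qquad \gamma_{n,j}(q)=\sum_{\sigma} q^{\mathrm{art}(\sigma)}, \] where the sum defining $\gamma_{n,j}(q)$ runs over all primary odd-odd-descent permutations $\sigma\in\mathcal{W}^*_{2n+1}$ with $j$ descents. Moreover, setting $\gamma_{0,0}(q)=1$, \[ \sum_{n\ge 0}\Big(\sum_{j=0}^{\lfloor n/2\rfloor} \gamma_{n,j}(q) t^j \Big)x^n=\cfrac{1}{1-\mu_0 x-\cfrac{\lambda_1 x^2}{1-\mu_1 x-\cfrac{\lambda_2 x^2}{1-\mu_2 x-\cdots}}}, \] where $\mu_h=[h+1]_q^2$ for $h\ge 0$ and $\lambda_h=[h]_q^2[h+1]_q^2\,t$ for $h\ge 1$.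
   Context: $[k]_q=1+q+\cdots+q^{k-1}$. For $\sigma=\sigma_1\cdots\sigma_n\in\mathfrak{S}_n$ (permutations of $[n]$), a descent is an index $i\in[n-1]$ with $\sigma_i>\sigma_{i+1}$ (descent pair $(\sigma_i,\sigma_{i+1})$), and $\mathrm{des}(\sigma)$ is the number of descents. A descent pair is odd-odd if both entries are odd. $\mathcal{W}_n$ is the set of $\sigma\in\mathfrak{S}_n$ all of whose descent pairs are odd-odd, and $\mathcal{W}^*_{2n+1}$ is the set of $\sigma\in\mathcal{W}_{2n+1}$ whose last entry $\sigma_{2n+1}$ is odd. With the convention $\sigma_0=\sigma_{n+1}=0$, the entry $\sigma_i$ ($1\le i\le n$) is a peak if $\sigma_{i-1}<\sigma_i>\sigma_{i+1}$, a valley if $\sigma_{i-1}>\sigma_i<\sigma_{i+1}$, a double descent if $\sigma_{i-1}>\sigma_i>\sigma_{i+1}$, a double ascent if $\sigma_{i-1}<\sigma_i<\sigma_{i+1}$. For $i\in[n]$ let $v(i)$ (resp. $p(i)$) be the number of valleys (resp. peaks) of $\sigma$ that are less than $i$ and located to the left of the entry $i$ in $\sigma$; define $\mathrm{art}(\sigma)=\sum_{i=1}^n (v(i)-p(i))$. A permutation $\sigma\in\mathcal{W}^*_{2n+1}$ is a primary odd-odd-descent permutation if $\sigma$ has no double descent and $\sigma_{2n}<\sigma_{2n+1}$. *)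

(* Defs.v *)
From HB Require Import structures.
From mathcomp Require Import all_boot all_order all_algebra.
Set Implicit Arguments. Unset Strict Implicit. Unset Printing Implicit Defensive.
Import Order.TTheory GRing.Theory Num.Theory.

Definition perms (m : nat) : seq (seq nat) := permutations (iota 1 m).

(* entry sigma_i for 1 <= i <= m, with convention sigma_0 = sigma_{m+1} = 0 *)
Definition ent (s : seq nat) (i : nat) : nat :=
  if (0 < i <= size s) then nth 0 s i.-1 else 0.

Definition is_descent (s : seq nat) (i : nat) : bool := ent s i.+1 < ent s i.
Definition des (s : seq nat) : nat := count (is_descent s) (iota 1 (size s).-1).

Definition oddodd (s : seq nat) : bool :=
  all (fun i => is_descent s i ==> (odd (ent s i) && odd (ent s i.+1)))
      (iota 1 (size s).-1).

Definition inWstar (s : seq nat) : bool := oddodd s && odd (ent s (size s)).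

Definition is_peak (s : seq nat) (i : nat) : bool :=
  (ent s i.-1 < ent s i) && (ent s i.+1 < ent s i).
Definition is_valley (s : seq nat) (i : nat) : bool :=
  (ent s i < ent s i.-1) && (ent s i < ent s i.+1).
Definition is_ddesc (s : seq nat) (i : nat) : bool :=
  (ent s i < ent s i.-1) && (ent s i.+1 < ent s i).

(* v(a), p(a): valleys (peaks) less than a located to the left of the entry a;
   the entry a sits at position (index a s).+1, so positions 1 .. index a s *)
Definition vcnt (s : seq nat) (a : nat) : nat :=
  count (fun k => is_valley s k && (ent s k < a)) (iota 1 (index a s)).
Definition pcnt (s : seq nat) (a : nat) : nat :=
  count (fun k => is_peak s k && (ent s k < a)) (iota 1 (index a s)).

Definition art (s : seq nat) : int :=
  (\sum_(a <- iota 1 (size s)) ((vcnt s a)%:Z - (pcnt s a)%:Z))%R.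

Definition primary (s : seq nat) : bool :=
  [&& inWstar s, all (fun i => ~~ is_ddesc s i) (iota 1 (size s)) &
      ent s (size s).-1 < ent s (size s)].

Local Open Scope ring_scope.

Definition qint (R : comUnitRingType) (q : R) (k : nat) : R := \sum_(i < k) q ^+ i.

Definition Wpoly (R : comUnitRingType) (q t : R) (n : nat) : R :=
  \sum_(s <- perms (2 * n).+1 | inWstar s) q ^ art s * t ^+ des s.

Definition gamma (R : comUnitRingType) (q : R) (n j : nat) : R :=
  \sum_(s <- perms (2 * n).+1 | primary s && (des s == j)) q ^ art s.

Definition series (R : comUnitRingType) := nat -> R.
Definition sone (R : comUnitRingType) : series R := fun n => (n == 0%N)%:R.
Definition szero (R : comUnitRingType) : series R := fun _ => 0.
Definition sadd (R : comUnitRingType) (f g : series R) : series R := fun n => f n + g n.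
Definition ssub (R : comUnitRingType) (f g : series R) : series R := fun n => f n - g n.
Definition sscale (R : comUnitRingType) (c : R) (f : series R) : series R :=
  fun n => c * f n.
Definition sshift (R : comUnitRingType) (f : series R) : series R :=
  fun n => if n is n'.+1 then f n' else 0.
Definition smul (R : comUnitRingType) (f g : series R) : series R :=
  fun n => \sum_(k < n.+1) f k * g (n - k)%N.
Definition spow (R : comUnitRingType) (g : series R) (k : nat) : series R :=
  iter k (smul g) (sone R).
(* inverse of a series f with constant term 1: 1/f = sum_k (1 - f)^k
   (only k <= n contributes to the coefficient of x^n) *)
Definition sinv (R : comUnitRingType) (f : series R) : series R :=
  fun n => \sum_(k < n.+1) spow (ssub (sone R) f) k n.

Definition mu (R : comUnitRingType) (q : R) (h : nat) : R := qint q h.+1 ^+ 2.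
Definition lam (R : comUnitRingType) (q t : R) (h : nat) : R :=
  qint q h ^+ 2 * qint q h.+1 ^+ 2 * t.

Fixpoint cfrac (R : comUnitRingType) (q t : R) (d k : nat) : series R :=
  match d with
  | 0 => szero R
  | d'.+1 =>
      sinv (ssub (sone R)
              (sadd (sscale (mu q k) (sshift (sone R)))
                    (sscale (lam q t k.+1) (sshift (sshift (cfrac q t d' k.+1))))))
  end.

Definition gammaGF (R : comUnitRingType) (q t : R) : series R :=
  fun n => if n == 0%N then 1
           else \sum_(j < (n./2).+1) gamma q n j * t ^+ j.

(* Main.v *)
(** By telescoping, [v(a) - p(a)] counts the descents [(b, c)] to the left of [a] with
    [b > a > c], so [art] counts the occurrences of the pattern 31-2.  Moreover
    [W*_{2n+1}] consists of the permutations whose even entries are all double ascents,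
    and the primary ones have no double descent.

    Insert the values 1, 2, ... in increasing order, keeping track of the gaps that
    larger values must still fill.  A new entry chooses one of [m] gaps and becomes a
    peak, double descent, double ascent or valley according to the gaps it leaves on
    its two sides; the gaps to its left are its 31-2 occurrences, so the choice of the
    gap contributes [[m]_q].  Grouping the insertions of [2i-1] and [2i] turns the
    permutations into Motzkin paths of length [n] with level weights [y [h+1]_q^2] and
    up-down weights [lambda_h], where [y = 1 + t] for [W*_{2n+1}] and [y = 1] for the
    primary permutations.  A path with [j] up steps has [n - 2j] level steps, which
    gives the gamma-expansion, and the continued fraction is Flajolet's. *)

Require Import Defs.
From HB Require Import structures.
From mathcomp Require Import all_boot all_order all_algebra.
From mathcomp Require Import zify ring.
Import Order.TTheory GRing.Theory Num.Theory.
Local Open Scope ring_scope.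

Set Implicit Arguments.
Unset Strict Implicit.
Unset Printing Implicit Defensive.

(** * Insertion of entries in increasing order *)

Section Gaps.
Local Open Scope nat_scope.
(* A letter larger than all entries, standing for a maximal run of entries still to be inserted. *)
Variable M : nat.
Hypothesis M_gt0 : 0 < M.

(** A gap is a nonempty run of larger entries, so placing [a] in it leaves a gap or nothing on each
    side. *)
Fixpoint expand (a : nat) (c : seq nat) : seq (seq nat) :=
  if c is x :: c' then
    (if x == M then [:: a :: c'; M :: a :: c'; a :: M :: c'; M :: a :: M :: c']
     else [::]) ++ map (cons x) (expand a c')
  else [::].

Fixpoint configs (a : nat) : seq (seq nat) :=
  if a is a'.+1 then flatten (map (expand a) (configs a')) else [:: [:: M]].

Definition nogap2 (x y : nat) : bool := (x != M) || (y != M).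

(** Two adjacent gaps would form a single run; nonemptiness rules out the empty word at [a = 0]. *)
Definition is_config (a : nat) (w : seq nat) : bool :=
  [&& perm_eq (filter (predC1 M) w) (iota 1 a), sorted nogap2 w & w != [::]].

(** An insertion is undone by turning [a] back into a gap and merging it with the gaps next to
    it. *)
Definition gapify (a x : nat) : nat := if x == a then M else x.

Fixpoint squash (s : seq nat) : seq nat :=
  if s is x :: s' then
    if (x == M) && (head 0 s' == M) then squash s' else x :: squash s'
  else [::].

Definition collapse (a : nat) (w : seq nat) : seq nat := squash (map (gapify a) w).

Lemma sorted_nogap2_cons x s :
  sorted nogap2 (x :: s) = ~~ ((x == M) && (head 0 s == M)) && sorted nogap2 s.
Proof.
case: s => [|y s] /=; first by rewrite (_ : (0 == M) = false) ?andbF //; lia.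
by rewrite /nogap2 negb_and.
Qed.

Lemma iota_rcons1 a : iota 1 a.+1 = rcons (iota 1 a) a.+1.
Proof. by rewrite -cats1 -[a.+1 in LHS]addn1 iotaD. Qed.

Lemma head_squash s : head 0 (squash s) = head 0 s.
Proof.
elim: s => //= x s IH; case: ifP => //= /andP[/eqP-> /eqP hs].
by rewrite IH.
Qed.

Lemma squash_id s : sorted nogap2 s -> squash s = s.
Proof.
elim: s => // x s IH; rewrite sorted_nogap2_cons => /andP[/negbTE /= -> /IH].
by move=> ->.
Qed.

Lemma sorted_squash s : sorted nogap2 (squash s).
Proof.
elim: s => // x s IH /=; case: ifP => // h.
by rewrite sorted_nogap2_cons head_squash h.
Qed.

Lemma map_gapify_id a s : a \notin s -> map (gapify a) s = s.
Proof.
move=> has; rewrite -[RHS]map_id; apply/eq_in_map => x xs; rewrite /gapify.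
by case: eqP => // xa; rewrite -xa xs in has.
Qed.

Lemma collapse_expand a c w : a != M -> a \notin c -> sorted nogap2 c ->
  w \in expand a c -> collapse a w = c.
Proof.
move=> aM; elim: c w => // x c IH w; rewrite inE negb_or => /andP[ax ac].
move=> sxc; have := sxc; rewrite sorted_nogap2_cons => /andP[xc sc].
have gM : gapify a M = M by rewrite /gapify; case: ifP.
have ga : gapify a a = M by rewrite /gapify eqxx.
rewrite /= mem_cat => /orP[|/mapP[w' w'in ->]].
  case: (eqVneq x M) sxc => [-> sxc|//].
  have e s : squash (M :: M :: s) = squash (M :: s) by rewrite /= eqxx.
  by rewrite !inE => /or4P[] /eqP->;
    rewrite /collapse !map_cons ?gM ?ga (map_gapify_id ac) ?e (squash_id sxc).
have E := IH _ ac sc w'in.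
rewrite /collapse map_cons /= -/(collapse a w') E.
rewrite -head_squash -/(collapse a w') E.
by rewrite /gapify (eq_sym x) (negbTE ax) (negbTE xc).
Qed.

Lemma expand_uniq a c : a != M -> a \notin c -> sorted nogap2 c ->
  uniq (expand a c).
Proof.
move=> aM; elim: c => // x c IH; rewrite inE negb_or => /andP[ax ac].
rewrite sorted_nogap2_cons => /andP[xc sc].
rewrite /= cat_uniq map_inj_uniq ?IH ?andbT //; last by move=> ? ? [].
case: (eqVneq x M) xc => [-> /= hc|_ _]; last by apply/hasPn.
apply/andP; split.
  have hs v : v == M :: v = false by apply/eqP => /(congr1 size) /=; lia.
  have Ma : (M == a) = false by rewrite eq_sym (negbTE aM).
  by rewrite !inE !eqseq_cons !(Ma, negbTE aM, eqxx, hs).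
(* A later insertion keeps the leading gap, followed by a letter [y] that is neither [a] nor a gap;
   a filling of the leading gap never begins this way. *)
apply/hasPn => w /mapP[w' w'in ->].
case: c ac hc sc w'in {IH} => [|y c] //=; rewrite inE negb_or => /andP[ay ac] yM _.
rewrite (negbTE yM) /= => /mapP[w'' _ ->].
by rewrite !inE !eqseq_cons (eq_sym M a) (negbTE aM) (eq_sym y a) (negbTE ay) /= !andbF.
Qed.

Lemma head_expand a c w : w \in expand a c ->
  head 0 w = head 0 c \/ head 0 c = M.
Proof.
case: c => //= x c; rewrite mem_cat => /orP[|/mapP[w' _ ->]]; last by left.
by case: eqP => //; right.
Qed.

Lemma expand_config a c w : a.+1 != M -> is_config a c ->
  w \in expand a.+1 c -> is_config a.+1 w.
Proof.
move=> aM /and3P[pc sc _] wc.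
suff [pw sw] : perm_eq (filter (predC1 M) w) (a.+1 :: filter (predC1 M) c) /\
   sorted nogap2 w.
  apply/and3P; split=> //; last by case: w pw {wc sw} => // /perm_size.
  by rewrite (perm_trans pw) // iota_rcons1 perm_sym perm_rcons perm_sym perm_cons.
elim: c w sc wc {pc} => // x c IH w; rewrite sorted_nogap2_cons => /andP[xc sc].
rewrite /= mem_cat => /orP[|/mapP[w' w'in ->]].
  case: (eqVneq x M) xc => [-> /= hc|//].
  have aM' := negbTE aM; have h0 : (0 == M) = false by lia.
  rewrite !inE => /or4P[] /eqP->;
   rewrite !sorted_nogap2_cons /= ?eqxx /= ?aM' /= ?h0 ?andbF ?hc //=;
   split => //.
have [pw sw] := IH _ sc w'in.
rewrite sorted_nogap2_cons sw andbT; split => /=.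
  case: ifP => // _.
  apply: (@perm_trans _ (x :: a.+1 :: filter (predC1 M) c)); first by rewrite perm_cons.
  exact/permPl/(perm_catCA [:: x] [:: a.+1]).
case: (eqVneq x M) xc => [_ /= hc|//].
by case: (head_expand w'in) => hw; [rewrite hw | rewrite hw eqxx in hc].
Qed.

Lemma mem_expand_collapse a w : a != M -> count_mem a w = 1 ->
  sorted nogap2 w -> w \in expand a (collapse a w).
Proof.
move=> aM; rewrite /collapse.
have gM : gapify a M = M by rewrite /gapify; case: ifP.
have ga : gapify a a = M by rewrite /gapify eqxx.
elim: w => // x w IH; rewrite sorted_nogap2_cons => /= cw /andP[xw sw].
case: (eqVneq x a) cw xw => [-> /= cw _|xa cw xw].
  have aw : a \notin w by apply/count_memPn; apply: (@addnI 1).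
  rewrite ga map_gapify_id // eqxx /= squash_id //.
  case: ifP; last by rewrite /= eqxx mem_cat inE eqxx.
  by case: w {IH cw sw aw} => [|y w] /= /eqP yM; [lia|rewrite yM eqxx !inE eqxx !orbT].
have {}IH := IH cw sw.
rewrite {1}/gapify (negbTE xa).
case: ifP => [/andP[/eqP xM hM]|_]; last first.
  by rewrite /= mem_cat orbC {1}/gapify (negbTE xa) map_f.
subst x; rewrite eqxx /= in xw.
case: w hM xw sw cw {IH} => [|y w] /=; first by move=> ->.
rewrite {1}/gapify; case: (eqVneq y a) => [-> _ _ sw cw|_ -> //].
have aw : a \notin w by apply/count_memPn; apply: (@addnI 1).
have {}sw : sorted nogap2 w by move: sw; case: w {cw aw} => //= z w /andP[].
rewrite ga map_gapify_id // eqxx /= squash_id //.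
case: ifP; last by rewrite /= eqxx mem_cat !inE eqxx !orbT.
by case: w {cw sw aw} => [|z w] /= /eqP zM; [lia|rewrite zM eqxx !inE eqxx !orbT].
Qed.

Lemma filter_squash s : filter (predC1 M) (squash s) = filter (predC1 M) s.
Proof.
by elim: s => //= x s IH; case: ifP => [/andP[-> _] //|_ /=]; rewrite IH.
Qed.

Lemma filter_gapify a w :
  filter (predC1 M) (map (gapify a) w) = filter (predC1 a) (filter (predC1 M) w).
Proof.
elim: w => //= x w IH; rewrite {1}/gapify.
case: (eqVneq x a) => [->|xa]; first by rewrite eqxx; case: ifP; rewrite /= ?eqxx.
by case: ifP => /= _; rewrite ?xa IH // /gapify (negbTE xa).
Qed.

Lemma squash_eq0 s : (squash s == [::]) = (s == [::]).
Proof.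
elim: s => //= x s IH; case: ifP => // /andP[_ /eqP hM].
by rewrite IH; case: s hM {IH} => //= M0; have := M_gt0; rewrite -M0.
Qed.

Lemma collapse_config a w : is_config a.+1 w -> is_config a (collapse a.+1 w).
Proof.
case/and3P=> pw sw w0; rewrite /is_config sorted_squash squash_eq0 /=.
rewrite filter_squash filter_gapify -size_eq0 size_map size_eq0 w0 andbT.
rewrite (perm_trans (perm_filter _ pw)) //.
rewrite iota_rcons1 filter_rcons /= eqxx /= (eq_in_filter (a2 := predT)) ?filter_predT //.
by move=> x; rewrite mem_iota /=; lia.
Qed.

Lemma config_letters a w x : is_config a w -> x \in w -> (x <= a) || (x == M).
Proof.
move=> /and3P[/perm_mem pw _ _] xw; case: (eqVneq x M) => xM; rewrite ?orbT //.
by have := pw x; rewrite mem_filter /= xM xw mem_iota /=; lia.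
Qed.

(** [collapse] assigns to every configuration its only possible parent, so the expansions of
    distinct configurations are disjoint and together exhaust the next size. *)
Lemma configs_enum a : a < M -> uniq (configs a) /\ configs a =i is_config a.
Proof.
elim: a => [|a IH] aM.
  split=> // w; rewrite inE /is_config [RHS]unfold_in /=.
  apply/eqP/and3P => [->|[/perm_nilP pw sw w0]]; first by rewrite /= eqxx.
  have wM x : x \in w -> x = M.
    move=> xw; apply/eqP/negPn/negP => xM.
    by have := mem_filter (predC1 M) x w; rewrite pw /= xM xw.
  case: w pw sw wM w0 => [|x [|y w]] //= pw sw wM _.
    by rewrite (wM x) ?inE ?eqxx.
  have xM : x = M by apply: wM; rewrite inE eqxx.
  have yM : y = M by apply: wM; rewrite !inE eqxx orbT.
  by move: sw; rewrite /nogap2 xM yM eqxx.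
have [|u c] := IH; first by lia.
have aM1 : a.+1 != M by lia.
have notin d : d \in configs a -> a.+1 \notin d.
  rewrite c => dc; apply/negP => ad; have := config_letters dc ad.
  by rewrite ltnn (negbTE aM1).
have srt d : d \in configs a -> sorted nogap2 d.
  by rewrite c => /and3P[].
split=> [|w]; last first.
  apply/flatten_mapP/idP => [[d dc wd]|wc].
    by apply: (expand_config aM1 _ wd); rewrite c in dc.
  exists (collapse a.+1 w); first by rewrite c; apply: collapse_config.
  case/and3P: wc => pw sw w0; apply: mem_expand_collapse => //.
  have := permP pw (pred1 a.+1).
  rewrite count_filter (eq_count (a2 := pred1 a.+1)) => [->|x /=].
    by rewrite iota_rcons1 -cats1 count_cat /= eqxx (count_memPn _) ?mem_iota //; lia.
  by case: eqP => // ->.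
move: u notin srt; rewrite /=; elim: (configs a) => [|d cs IHd] //= /andP[dcs ucs] notin srt.
rewrite cat_uniq IHd //; last 2 first.
  by move=> e ecs; apply: notin; rewrite inE ecs orbT.
  by move=> e ecs; apply: srt; rewrite inE ecs orbT.
have dd : d \in d :: cs by rewrite inE eqxx.
rewrite (expand_uniq aM1 (notin _ dd) (srt _ dd)) andbT /=.
apply/hasPn => w /flatten_mapP[e ecs we]; apply/negP => wd.
have ee : e \in d :: cs by rewrite inE ecs orbT.
move: ecs dcs; rewrite -(collapse_expand aM1 (notin _ ee) (srt _ ee) we).
by rewrite (collapse_expand aM1 (notin _ dd) (srt _ dd) wd) => ->.
Qed.

End Gaps.

(** * Weights of words with gaps *)

(* [qint] over rings without inverses, so that it applies to [{poly R}]. *)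
Definition qnum (R : comNzRingType) (q : R) (k : nat) : R := \sum_(i < k) q ^+ i.

Lemma qnum0 (R : comNzRingType) (q : R) : qnum q 0 = 0.
Proof. by rewrite /qnum big_ord0. Qed.

Lemma qnumS (R : comNzRingType) (q : R) k : qnum q k.+1 = 1 + q * qnum q k.
Proof.
rewrite /qnum big_ord_recl expr0 mulr_sumr; congr (_ + _).
by apply: eq_bigr => i _; rewrite -exprS.
Qed.

(* The argument [l] is the letter preceding [s]. *)
Fixpoint pat312 (l : nat) (s : seq nat) : nat :=
  if s is z :: s' then (count (fun x => z < x < l)%N s' + pat312 z s')%N else 0.

Section Weights.
Variables (R : comNzRingType) (q : R) (W : nat -> bool -> bool -> R) (M : nat).
Hypothesis M_gt0 : (0 < M)%N.

(** The flags of [W] compare [x] with its left and right neighbours. Starting from [l = 0], and with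
    the default 0 of [head], they follow the convention that a permutation is bordered by zeros. *)
Fixpoint tweight (l : nat) (s : seq nat) : R :=
  if s is x :: s' then
    (if x == M then 1 else W x (l < x)%N (head 0%N s' < x)%N) * tweight x s'
  else 1.

Definition weight (l : nat) (s : seq nat) : R := q ^+ pat312 l s * tweight l s.

(* In this order, [a] becomes a peak, a double descent, a double ascent, a valley. *)
Definition fillings (a : nat) : seq (seq nat) := [:: [:: a]; [:: M; a]; [:: a; M]; [:: M; a; M]].

Definition filling_weight (a : nat) (X : seq nat) : R :=
  W a (head 0%N X == a) (last 0%N X == a).

(** Only the factor of [a] is new: the neighbours of the gap are entries below both [a] and [M], so
    their own comparisons do not change. *)
Lemma tweight_filling a l u v X : (0 < a < M)%N -> X \in fillings a ->
  path (nogap2 M) l (u ++ M :: v) -> all (fun x => (x < a) || (x == M))%N (l :: u ++ v) ->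
  tweight l (u ++ X ++ v) = filling_weight a X * tweight l (u ++ M :: v).
Proof.
move=> /andP[a0 aM] XX; elim: u l => [|x u IH] l /=.
  move=> /andP[lM pv] /andP[la av].
  have {la}la : (l < a)%N by move: lM la; rewrite /nogap2 eqxx orbF => /negbTE ->; rewrite orbF.
  have la0 : (a < l)%N = false by lia.
  have aM' : (a == M) = false by lia.
  have Ma : (M == a) = false by lia.
  have lM0 : (M < a)%N = false by lia.
  have tv : tweight a v = tweight M v.
    case: v pv av => //= y v /andP[yM _] /andP[ya _]; congr (_ * _).
    have {}ya : (y < a)%N by move: yM ya; rewrite /nogap2 eqxx /= => /negbTE ->; rewrite orbF.
    have -> : (a < y)%N = false by lia.
    by have -> : (M < y)%N = false by lia.
  have hv : (head 0%N v < a)%N.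
    case: v pv av {tv} => //= y v /andP[yM _] /andP[ya _].
    by move: yM ya; rewrite /nogap2 eqxx /= => /negbTE ->; rewrite orbF.
  by move: XX; rewrite !inE => /or4P[] /eqP->; rewrite /filling_weight /= !eqxx
    !aM' ?Ma ?la ?hv ?lM0 ?tv !mul1r.
move=> /andP[lx pv] /and3P[la xa av].
rewrite mulrCA -IH ?pv /= ?xa //; congr (_ * _).
case: (eqVneq x M) => // xM; rewrite (negbTE xM) orbF in xa.
case: u pv {IH av} => [|y u] //= pv.
have -> : (M < x)%N = false by lia.
suff -> : (head 0%N (X ++ v) < x)%N = false by [].
by move: XX; rewrite !inE => /or4P[] /eqP-> /=; lia.
Qed.

(** Each gap to the left is followed by an entry below [a], hence forms with [a] one new occurrence.
    A descent from [a] or from [M] sees the same intermediate letters, since all other entries are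
    below [a]. *)
Lemma pat312_filling a l u v X : (0 < a < M)%N -> X \in fillings a ->
  path (nogap2 M) l (u ++ M :: v) -> all (fun x => (x < a) || (x == M))%N (l :: u ++ v) ->
  pat312 l (u ++ X ++ v) = (count_mem M (l :: u) + pat312 l (u ++ M :: v))%N.
Proof.
move=> /andP[a0 aM] XX; elim: u l => [|x u IH] l.
  rewrite !cat0s => /= /andP[lM pv] /andP[la av].
  have {la}la : (l < a)%N by move: lM la; rewrite /nogap2 eqxx orbF => /negbTE ->; rewrite orbF.
  have -> : (l == M) = false by lia.
  have c0 z s : (a <= z)%N -> count (fun x => z < x < l)%N s = 0.
    by move=> az; apply/eqP; rewrite -leqn0 leqNgt -has_count; apply/hasPn => x _; lia.
  have c1 z s : (M <= z)%N || (a <= z)%N -> count (fun x => z < x < a)%N s = 0.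
    by move=> az; apply/eqP; rewrite -leqn0 leqNgt -has_count; apply/hasPn => x _; lia.
  have e : pat312 a v = pat312 M v.
    case: v pv av => //= y v /andP[yM _] /andP[ya av]; congr (_ + _)%N.
    apply: eq_in_count => x xv; have /= := allP av x xv; lia.
  have c2 : count (fun x => a < x < M)%N v = 0.
    apply/eqP; rewrite -leqn0 leqNgt -has_count; apply/hasPn => x xv.
    have /= := allP av x xv; lia.
  move: XX; rewrite !inE => /or4P[] /eqP-> /=; rewrite ?c0 ?c1 ?c2 ?e
    ?ltnn ?andbF /= ?(ltnW aM) ?leqnn //; lia.
rewrite !cat_cons => /= /andP[lx pv] /and3P[la xa av].
rewrite (IH x) //= ?xa // !count_cat /=.
have -> : count (fun y => x < y < l)%N X = (l == M :> nat)%N.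
  have lM : (l <= M)%N by lia.
  move: lx la xa; rewrite /nogap2 => lx la xa.
  move: XX; rewrite !inE => /or4P[] /eqP-> /=; lia.
by have -> : (x < M < l)%N = false; lia.
Qed.

Lemma weight_filling a l u v X : (0 < a < M)%N -> X \in fillings a ->
  path (nogap2 M) l (u ++ M :: v) -> all (fun x => (x < a) || (x == M))%N (l :: u ++ v) ->
  weight l (u ++ X ++ v) =
    q ^+ count_mem M (l :: u) * filling_weight a X * weight l (u ++ M :: v).
Proof.
move=> ha hX hp hA; rewrite /weight (tweight_filling ha hX hp hA) (pat312_filling ha hX hp hA).
by rewrite exprD; ring.
Qed.

(** A valley splits a gap in two, a double ascent or double descent keeps it, a peak closes it; [F]
    is a test function of the resulting number of gaps. *)
Definition step_op (a : nat) (F : nat -> R) (m : nat) : R :=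
  W a false false * F m.+1 + (W a true false + W a false true) * F m
  + W a true true * F m.-1.

(** The gap chosen contributes [q] to the number of gaps on its left, and these powers add up to a
    [q]-integer. The prefix [u] holds the letters already scanned. *)
Lemma sum_expand a u c (F : nat -> R) : (0 < a < M)%N ->
  path (nogap2 M) 0 (u ++ c) -> all (fun x => (x < a) || (x == M))%N (u ++ c) ->
  \sum_(w <- expand M a c) F (count_mem M (u ++ w)) * weight 0 (u ++ w) =
  q ^+ count_mem M u * qnum q (count_mem M c) * step_op a F (count_mem M (u ++ c))
    * weight 0 (u ++ c).
Proof.
move=> ha; elim: c u => [|x c IH] u hp hA.
  by rewrite big_nil qnum0; ring.
rewrite [expand _ _ _]/= big_cat big_map.
have -> : \sum_(i <- expand M a c) F (count_mem M (u ++ x :: i)) * weight 0 (u ++ x :: i) =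
  q ^+ count_mem M (rcons u x) * qnum q (count_mem M c)
   * step_op a F (count_mem M (u ++ x :: c)) * weight 0 (u ++ x :: c).
  rewrite -cat_rcons -IH ?cat_rcons //.
  by apply: eq_bigr => i _; rewrite cat_rcons.
rewrite -cats1 count_cat /= addn0.
case: (eqVneq x M) hp hA => [->|_] hp hA; last by rewrite big_nil /= addn0 add0r.
have hA' : all (fun x => (x < a) || (x == M))%N (0%N :: u ++ c).
  move: hA; rewrite !all_cat /= !all_cat /= => /and3P[-> _ ->].
  by have -> : (0 < a)%N by lia.
have wf X : X \in fillings a -> weight 0 (u ++ X ++ c) =
    q ^+ count_mem M u * filling_weight a X * weight 0 (u ++ M :: c).
  move=> hX; rewrite (weight_filling ha hX hp hA') /=.
  by rewrite (_ : (0%N == M) = false) //; lia.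
rewrite !big_cons big_nil.
rewrite -[a :: c]/([:: a] ++ c) -[M :: a :: c]/([:: M; a] ++ c).
rewrite -[a :: M :: c]/([:: a; M] ++ c) -[M :: a :: M :: c]/([:: M; a; M] ++ c).
rewrite !wf ?inE ?eqxx ?orbT // /filling_weight /= !eqxx.
have aM' : (a == M) = false by lia.
have Ma : (M == a) = false by lia.
rewrite !count_cat /= ?count_cat /= ?eqxx ?aM' ?Ma ?add0n.
change (nat_of_bool true) with 1%N.
rewrite !add1n exprD expr1 qnumS /step_op !addnS /=.
by ring.
Qed.

Definition config_sum (a m : nat) : R :=
  \sum_(c <- configs M a | count_mem M c == m) weight 0 c.

Lemma config_sum0 m : config_sum 0 m = (m == 1%N)%:R.
Proof.
rewrite /config_sum /= big_cons big_nil /weight /= eqxx /= expr0 !mul1r addr0.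
by rewrite eq_sym; case: eqP.
Qed.

Lemma config_sumS a m : (a.+1 < M)%N ->
  config_sum a.+1 m =
    (W a.+1 true false + W a.+1 false true) * qnum q m * config_sum a m
  + W a.+1 true true * qnum q m.+1 * config_sum a m.+1
  + (if m is m'.+1 then W a.+1 false false * qnum q m' * config_sum a m' else 0).
Proof.
move=> aM.
have [|_ cE] := @configs_enum M M_gt0 a; first by lia.
(* This test function selects the insertions that leave [m] gaps. *)
pose F k : R := (k == m)%:R.
have -> : config_sum a.+1 m = \sum_(c <- configs M a)
   qnum q (count_mem M c) * step_op a.+1 F (count_mem M c) * weight 0 c.
  rewrite /config_sum /= [LHS]big_mkcond big_flatten big_map.
  apply: eq_big_seq => c; rewrite cE => cc.
  have {cc}[hp hA] : path (nogap2 M) 0 c /\ all (fun x => (x < a.+1) || (x == M))%N c.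
    split; last by apply/allP => x /(config_letters M_gt0 cc); rewrite ltnS.
    case/and3P: cc => _ sc _; case: c sc {cE} => //= x c ->; rewrite andbT /nogap2.
    by have -> : (0%N != M) by lia.
  have := @sum_expand a.+1 [::] c F aM hp hA; rewrite !cat0s /= expr0 mul1r => <-.
  apply: eq_bigr => w _; rewrite /F.
  by case: eqP => _; rewrite ?mul1r ?mul0r.
have csE k : config_sum a k =
    \sum_(c <- configs M a) (count_mem M c == k)%:R * weight 0 c.
  rewrite /config_sum big_mkcond; apply: eq_bigr => w _.
  by case: eqP => _; rewrite ?mul1r ?mul0r.
rewrite !csE ![_ * \sum_(c <- configs M a) _]mulr_sumr.
have -> : (if m is m'.+1 then W a.+1 false false * qnum q m' * config_sum a m' else 0) =
  \sum_(c <- configs M a) (W a.+1 false false * qnum q (count_mem M c) *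
     ((count_mem M c).+1 == m)%:R * weight 0 c).
  case: m @F => [|m] F; first by rewrite big1 // => c _; rewrite mulr0 mul0r.
  rewrite csE mulr_sumr; apply: eq_bigr => c _; rewrite eqSS.
  by case: eqP => [->|_]; rewrite ?mul0r ?mulr0 ?mul0r // mul1r mulr1.
rewrite -!big_split; apply: eq_bigr => c _ /=; rewrite /step_op /F {F}.
case: (count_mem M c) => [|k]; rewrite ?qnum0 /= ?eqSS.
  (* Without gaps the truncated predecessor in [step_op] is harmless, as it is multiplied by
     [qnum q 0 = 0]. *)
  by case: m => [|m]; rewrite ?qnum0 /=; ring.
have -> : (W a.+1 true false + W a.+1 false true) * qnum q m * ((k.+1 == m)%:R * weight 0 c)
  = (W a.+1 true false + W a.+1 false true) * qnum q k.+1 * ((k.+1 == m)%:R * weight 0 c).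
  by case: eqP => [->|_] //; rewrite !mul0r !mulr0.
have -> : W a.+1 true true * qnum q m.+1 * ((k == m)%:R * weight 0 c)
  = W a.+1 true true * qnum q k.+1 * ((k == m)%:R * weight 0 c).
  by case: eqP => [->|_] //; rewrite !mul0r !mulr0.
by ring.
Qed.

End Weights.

(** * The statistics of the theorem as weights *)

Lemma perm_filter_configs n :
  perm_eq (perms n.+1)
    (filter (fun c => count_mem n.+2 c == 0%N) (configs n.+2 n.+1)).
Proof.
have [//|//|u cE] := @configs_enum n.+2 _ n.+1; apply: uniq_perm.
- exact: permutations_uniq.
- exact: filter_uniq.
move=> s; rewrite mem_permutations mem_filter cE [in RHS]unfold_in.
have fs : n.+2 \notin s -> filter (predC1 n.+2) s = s.
  by move=> ns; apply/all_filterP/allP => x xs /=; apply: contraNneq ns => <-.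
apply/idP/andP => [ps|[/eqP/count_memPn ns /and3P[ps _ _]]]; last by rewrite fs in ps.
have ns : n.+2 \notin s by rewrite (perm_mem ps) mem_iota; lia.
split; first exact/eqP/count_memPn.
apply/and3P; split; [by rewrite fs| |by case: s ps {ns fs} => // /perm_size].
apply/(sortedP 0%N) => i /ltnW hi; apply/orP; left.
by apply: contraNneq ns => <-; apply: mem_nth.
Qed.

Lemma entE s i : ent s i = nth 0%N (0%N :: s) i.
Proof.
rewrite /ent; case: i => [|i] //=; case: ltnP => // h.
by rewrite nth_default.
Qed.

(** Counts the occurrences whose last letter is the given [a]. *)
Fixpoint pat312_at (a l : nat) (s : seq nat) : nat :=
  if s is z :: s' then
    if z == a then 0%N else ((z < a < l)%N + pat312_at a z s')%N
  else 0%N.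

Lemma pat312_sum l s : uniq s -> pat312 l s = (\sum_(a <- s) pat312_at a l s)%N.
Proof.
elim: s l => [|z s IH] l /=; first by rewrite big_nil.
move=> /andP[zs us]; rewrite big_cons eqxx add0n IH // -sum1_count big_mkcond -big_split.
apply: eq_big_seq => a as_ /=; case: eqP => [za|_]; last by case: ifP.
by rewrite za as_ in zs.
Qed.

(* Telescoping: [valley] - [peak] at a position is the difference of the descent
   indicators of its left and right junctions. *)
Lemma valley_peak_pat312 a l s : uniq (l :: s) -> a \in s -> a != l ->
  \sum_(k < index a s)
     (Posz [&& nth 0 s k < nth 0 (l :: s) k, nth 0 s k < nth 0 s k.+1
             & nth 0 s k < a]%N
     - Posz [&& nth 0 (l :: s) k < nth 0 s k, nth 0 s k.+1 < nth 0 s k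
             & nth 0 s k < a]%N)
  = Posz (pat312_at a l s) + Posz ((head 0 s < l) && (l < a))%N.
Proof.
elim: s l => // z s IH l /= /andP[]; rewrite inE negb_or => /andP[lz ls] /andP[zs us].
rewrite inE => as_ al; case: (eqVneq z a) as_ => [->|za] /=.
  by move=> _; rewrite big_ord0; lia.
move=> as_.
rewrite big_ord_recl /=.
have := IH z; rewrite /= zs us as_ eq_sym za => /(_ isT isT isT) ->.
case: s as_ zs {IH us ls} => // y s _; rewrite inE negb_or => /andP[zy _] /=; lia.
Qed.

Lemma big_iota1 (T : Type) (idx : T) (op : Monoid.law idx) n (F : nat -> T) :
  \big[op/idx]_(i <- iota 1 n) F i = \big[op/idx]_(i < n) F i.+1.
Proof.
rewrite (iotaDl 1 0 n) big_map -(big_mkord xpredT (fun i => F i.+1)) /index_iota subn0.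
by [].
Qed.

Lemma art_pat312 N s : s \in perms N -> art s = (pat312 0 s)%:Z.
Proof.
rewrite mem_permutations => ps.
have us : uniq s by rewrite (perm_uniq ps) iota_uniq.
have sz : size s = N by rewrite (perm_size ps) size_iota.
have s0 : 0%N \notin s by rewrite (perm_mem ps) mem_iota.
rewrite /art pat312_sum // sz -(perm_big _ ps) /= (big_morph Posz PoszD (erefl _)).
apply: eq_big_seq => a as_; have a0 : a != 0%N by apply: contraNneq s0 => <-.
have := @valley_peak_pat312 a 0 s; rewrite /= s0 us as_ a0 => /(_ isT isT isT).
(* The boundary term of the telescoping vanishes because no entry is below [l = 0]. *)
rewrite ?andbF ?addr0 => <-.
rewrite /vcnt /pcnt -!sum1_count big_mkcond [X in _ - X%:Z]big_mkcond !big_iota1.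
rewrite !(big_morph Posz PoszD (erefl _)) -sumrB; apply: eq_bigr => i _.
by rewrite /is_valley /is_peak !entE -!andbA; congr (Posz _ - Posz _); case: [&& _, _ & _].
Qed.

Section Link.
Variables (R : comNzRingType) (t z : R).

(* The weight t of a descent is carried by its bottom, and z marks double descents:
   z = 1 gives all of W*, z = 0 the primary permutations. *)
Definition ododd_weight (x : nat) (up down : bool) : R :=
  (if up then 1 else (odd x)%:R * t) * (if down then (odd x)%:R else 1)
  * (if ~~ up && down then z else 1).

Lemma tweight_prod (W : nat -> bool -> bool -> R) M l s : M \notin s ->
  tweight W M l s = \prod_(i < size s)
     W (nth 0%N s i) (nth 0 (l :: s) i < nth 0 s i)%N (nth 0 s i.+1 < nth 0 s i)%N.
Proof.
elim: s l => [|x s IH] l; first by rewrite big_ord0.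
by rewrite inE negb_or eq_sym => /andP[xM Ms]; rewrite /= (negbTE xM) big_ord_recl /= IH //.
Qed.

Lemma prod_if_count (I : Type) (r : seq I) (P : pred I) (x : R) :
  \prod_(i <- r) (if P i then x else 1) = x ^+ count P r.
Proof.
elim: r => [|i r IH]; rewrite ?big_nil // big_cons IH /=.
by case: (P i); rewrite ?mul1r // exprS.
Qed.

Lemma all_prod (I : Type) (r : seq I) (P : pred I) :
  (all P r)%:R = \prod_(i <- r) (P i)%:R :> R.
Proof.
elim: r => [|i r IH]; rewrite ?big_nil // big_cons -IH /=.
by case: (P i); rewrite ?mul1r ?mul0r.
Qed.

(** The [up] flag makes the bottom of each descent odd, the [down] flag its top. The last entry is
    followed by 0, so its [down] flag holds and imposes the odd last entry of [inWstar]. *)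
Lemma tweight_ododd n s : s \in perms n.+1 ->
  tweight ododd_weight n.+2 0 s =
  (inWstar s)%:R * t ^+ des s * z ^+ count (is_ddesc s) (iota 1 (size s)).
Proof.
rewrite mem_permutations => ps.
have us : uniq s by rewrite (perm_uniq ps) iota_uniq.
have sz : size s = n.+1 by rewrite (perm_size ps) size_iota.
have s0 : 0%N \notin s by rewrite (perm_mem ps) mem_iota.
have sM : n.+2 \notin s by rewrite (perm_mem ps) mem_iota; lia.
have pos i : (i < n.+1)%N -> (0 < nth 0%N s i)%N.
  by rewrite -sz => /(mem_nth 0%N) h; rewrite lt0n; apply: contraNneq s0 => <-.
have ne i : (i < n.+1)%N -> (nth 0%N (0%N :: s) i == nth 0%N (0%N :: s) i.+1) = false.
  by move=> hi; rewrite nth_uniq /= ?s0 ?us ?sz //; lia.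
rewrite tweight_prod // /ododd_weight !big_split /= -prod_if_count big_iota1.
congr (_ * _); last first.
  apply: eq_bigr => i _; rewrite /is_ddesc !entE /=; congr (if _ && _ then _ else _).
  by have := ne i; rewrite -sz ltn_ord /= => /(_ isT); case: ltngtP.
rewrite /inWstar /oddodd /des -mulnb natrM all_prod -prod_if_count sz !big_iota1 !entE /=.
(* Dropping the first bottom factor and setting apart the last top factor aligns both products on
   the junctions between consecutive entries. *)
rewrite big_ord_recl /= pos // mul1r [X in _ * X]big_ord_recr /=.
rewrite (@nth_default _ _ _ n.+1) ?sz // pos //.
rewrite mulrA [RHS]mulrAC; congr (_ * _).
rewrite -!big_split; apply: eq_bigr => i _ /=.
rewrite /is_descent !entE /=.
have := ne i.+1; rewrite /= ltnS ltn_ord => /(_ isT).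
case: ltngtP => // lt _; rewrite ?mul1r ?mulr1 //.
by rewrite /bump leq0n add1n -mulnb natrM; ring.
Qed.

End Link.

(** * Motzkin paths *)

Section Motzkin.

(** Weighted paths of [n] steps from 0 to [h], with the last step peeled off: level at [h], down
    from [h.+1], or up from [h.-1]. The factor [t] sits on the up steps. *)
Fixpoint motzkin (R : comNzRingType) (q t y : R) (n h : nat) : R :=
  if n is n'.+1 then
    y * qnum q h.+1 ^+ 2 * motzkin q t y n' h
    + qnum q h.+1 * qnum q h.+2 * motzkin q t y n' h.+1
    + (if h is h'.+1 then t * qnum q h * qnum q h.+1 * motzkin q t y n' h' else 0)
  else (h == 0%N)%:R.

(** The height is the number of gaps minus one. An odd value may have any of the four types and
    decides the step; the next, even value can only be a double ascent and contributes [[h+1]_q]. *)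
Lemma config_sum_motzkin (R : comNzRingType) (q t z : R) M n h : (2 * n < M)%N ->
  config_sum q (ododd_weight t z) M (2 * n) h.+1 = motzkin q t (1 + t * z) n h.
Proof.
elim: n h => [|n IH] h hM.
  by rewrite muln0 config_sum0.
have -> : (2 * n.+1 = (2 * n).+2)%N by lia.
have M0 : (0 < M)%N by lia.
rewrite (config_sumS q _ M0); last by lia.
rewrite (config_sumS q _ M0); last by lia.
rewrite (config_sumS q _ M0); last by lia.
have o : odd (2 * n) = false by rewrite mul2n odd_double.
rewrite /ododd_weight /= o /= !(mul1r, mulr1, mul0r, add0r, addr0).
case: h => [|h] /=; rewrite !IH ?qnum0; try lia; ring.
Qed.

(** The last value [2n+1] must close the only remaining gap as a peak, with factor [[1]_q = 1]. *)
Lemma sum_perms_motzkin (R : comNzRingType) (q t z : R) n :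
  \sum_(s <- perms (2 * n).+1) q ^+ pat312 0 s *
     ((inWstar s)%:R * t ^+ des s * z ^+ count (is_ddesc s) (iota 1 (size s)))
  = motzkin q t (1 + t * z) n 0.
Proof.
rewrite -(@config_sum_motzkin _ q t z (2 * n).+2) //.
transitivity (config_sum q (ododd_weight t z) (2 * n).+2 (2 * n).+1 0).
  rewrite -[RHS]big_filter -(perm_big _ (perm_filter_configs (2 * n))) /=.
  by apply: eq_big_seq => s sp; rewrite /weight tweight_ododd.
rewrite config_sumS // qnum0 /ododd_weight /= mul2n odd_double /= qnumS qnum0; ring.
Qed.

(** With [t] replaced by ['X], coefficient [j] collects the paths with [j] up steps. *)
Lemma coef_motzkinS (R : comNzRingType) (q : R) n h j :
  (motzkin q%:P 'X 1 n.+1 h)`_j =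
   qnum q h.+1 ^+ 2 * (motzkin q%:P 'X 1 n h)`_j +
   qnum q h.+1 * qnum q h.+2 * (motzkin q%:P 'X 1 n h.+1)`_j +
   (if h is h'.+1 then if j is j'.+1 then
      qnum q h * qnum q h.+1 * (motzkin q%:P 'X 1 n h')`_j' else 0 else 0).
Proof.
have qP k : qnum q%:P k = (qnum q k)%:P.
  by rewrite /qnum rmorph_sum; apply: eq_bigr => i _; rewrite rmorphXn.
rewrite /= !qP mul1r -polyC_exp -!polyCM !coefD !coefCM; congr (_ + _).
case: h => [|h]; first by rewrite coef0.
rewrite -!mulrA coefXM; case: j => //= j.
by rewrite mulrA -polyCM coefCM.
Qed.

(** A path to [h] with [j] up steps has [j - h] down steps, which forces [2j - h <= n]. *)
Lemma coef_motzkin0 (R : comNzRingType) (q : R) n h j : (n + h < 2 * j)%N ->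
  (motzkin q%:P 'X 1 n h)`_j = 0.
Proof.
elim: n h j => [|n IH] h j hj.
  by rewrite /= coefMn coef1; case: j hj => // j _; rewrite mul0rn.
rewrite coef_motzkinS !IH ?mulr0 ?add0r; try lia.
case: h hj => // h; case: j => // j hj; rewrite IH ?mulr0 //; lia.
Qed.

(** With [j] up and [j - h] down steps, [n + h - 2j] level steps remain, each carrying [y]. Any
    cutoff [K] beyond the nonzero coefficients will do. *)
Lemma motzkin_coef (R : comNzRingType) (q t y : R) n h K : (n + h < 2 * K)%N ->
  motzkin q t y n h =
  \sum_(j < K) (motzkin q%:P 'X 1 n h)`_j * t ^+ j * y ^+ (n + h - 2 * j).
Proof.
elim: n h K => [|n IH] h K hK.
  case: K hK => [|K] hK; first by lia.
  rewrite big_ord_recl big1 => [|i _]; last first.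
    by rewrite /= coefMn coef1 /= mul0rn !mul0r.
  by rewrite /= coefMn coef1; case: h hK => [|h] hK; rewrite /=; ring.
under eq_bigr => j _ do rewrite coef_motzkinS !mulrDl.
rewrite !big_split [LHS]/=; congr (_ + _ + _).
- rewrite (IH h K) 1?mulr_sumr; last by lia.
  (* Where the exponent would be truncated, the coefficient is zero. *)
  apply: eq_bigr => j _; case: (leqP (2 * j) (n + h)) => hj.
    have -> : (n.+1 + h - 2 * j = (n + h - 2 * j).+1)%N by lia.
    by rewrite [y ^+ _.+1]exprS; move: (y ^+ _) (t ^+ _) => Y T; ring.
  by rewrite coef_motzkin0 //; ring.
- rewrite (IH h.+1 K) 1?mulr_sumr; last by lia.
  by apply: eq_bigr => j _; rewrite addSnnS; ring.
case: h hK => [|h] hK; first by rewrite big1 // => j _; rewrite !mul0r.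
case: K hK => [|K] hK; first by lia.
(* An up step uses one factor of ['X], so the sum is reindexed from [j.+1] to [j]. *)
rewrite big_ord_recl /= !mul0r add0r (IH h K) 1?mulr_sumr; last by lia.
apply: eq_bigr => j _; rewrite /bump leq0n add1n.
have -> : (n.+1 + h.+1 - 2 * j.+1 = n + h - 2 * j)%N by lia.
by rewrite [t ^+ _.+1]exprS; move: (y ^+ _) (t ^+ _) => Y T; rewrite add0n; ring.
Qed.

End Motzkin.

(** * The continued fraction *)

Section Series.
Variable R : comUnitRingType.
Implicit Types f g h : series R.

(** Truncation to polynomials lets the Cauchy product inherit associativity. *)
Lemma coef_smul f g N n : (n < N)%N ->
  smul f g n = ((\poly_(i < N) f i) * (\poly_(i < N) g i))`_n.
Proof.
move=> nN; rewrite coefM; apply: eq_bigr => i _.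
by rewrite !coef_poly !ifT //; have := ltn_ord i; lia.
Qed.

Lemma smulA f g h n : smul f (smul g h) n = smul (smul f g) h n.
Proof.
transitivity ((\poly_(i < n.+1) f i * (\poly_(i < n.+1) g i * \poly_(i < n.+1) h i))`_n).
  rewrite coefM; apply: eq_bigr => i _.
  by rewrite coef_poly ltn_ord -(@coef_smul g h n.+1) // ltnS leq_subr.
rewrite mulrA coefM; apply: eq_bigr => i _.
by rewrite coef_poly ltnS leq_subr -(@coef_smul f g n.+1).
Qed.

Lemma smul1 f n : smul (sone R) f n = f n.
Proof.
rewrite /smul big_ord_recl big1 => [|i _]; last by rewrite /sone mul0r.
by rewrite /sone eqxx mul1r subn0 addr0.
Qed.

Lemma eq_smull f f' g n : f =1 f' -> smul f g n = smul f' g n.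
Proof. by move=> e; apply: eq_bigr => i _; rewrite e. Qed.

Lemma eq_smulr f g g' n : g =1 g' -> smul f g n = smul f g' n.
Proof. by move=> e; apply: eq_bigr => i _; rewrite e. Qed.

Lemma smul_shiftl f g n : smul (sshift f) g n = sshift (smul f g) n.
Proof.
by case: n => [|n]; rewrite /smul big_ord_recl /= mul0r add0r ?big_ord0.
Qed.

Lemma smul_shiftr f g n : smul f (sshift g) n = sshift (smul f g) n.
Proof.
case: n => [|n]; rewrite /smul big_ord_recr /= ?subnn /= mulr0 addr0 ?big_ord0 //.
by apply: eq_bigr => i _; rewrite subSn // -ltnS.
Qed.

Lemma smul_scaler f g c n : smul f (sscale c g) n = c * smul f g n.
Proof. by rewrite /smul mulr_sumr; apply: eq_bigr => i _; rewrite /sscale; ring. Qed.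

Lemma smulDl f g h n : smul (sadd f g) h n = smul f h n + smul g h n.
Proof. by rewrite /smul -big_split; apply: eq_bigr => i _; rewrite mulrDl. Qed.

Lemma smul_scalel f g c n : smul (sscale c f) g n = c * smul f g n.
Proof. by rewrite /smul mulr_sumr; apply: eq_bigr => i _; rewrite /sscale mulrA. Qed.

Lemma spow_lt g k n : g 0%N = 0 -> (n < k)%N -> spow g k n = 0.
Proof.
move=> g0; elim: k n => // k IH n nk.
rewrite -[LHS]/(smul g (spow g k) n) /smul big1 // => -[[|i] hi] _ /=.
  by rewrite g0 mul0r.
by rewrite IH ?mulr0 //; lia.
Qed.

(** Geometric series: since [1 - f] has no constant term, its powers beyond [n] do not reach degree
    [n], and the sum may be cut at any larger bound. *)
Lemma sinv_fix f n : f 0%N = 1 ->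
  sinv f n = sone R n + smul (ssub (sone R) f) (sinv f) n.
Proof.
move=> f0; set g := ssub _ _.
have g0 : g 0%N = 0 by rewrite /g /ssub /sone eqxx f0 subrr.
have sinvE m K : (m < K)%N -> sinv f m = \sum_(k < K) spow g k m.
  move=> mK; rewrite /sinv -/g -!(big_mkord xpredT (fun k => spow g k m)).
  rewrite (@big_cat_nat _ _ _ m.+1 0 K) //= [X in _ + X]big_nat_cond [X in _ + X]big1 ?addr0 //.
  by move=> i /andP[/andP[mi _] _]; apply: spow_lt.
rewrite (sinvE n n.+2) // big_ord_recl; congr (_ + _).
rewrite [RHS](eq_bigr (fun i : 'I_n.+1 => \sum_(k < n.+1) g i * spow g k (n - i)%N)).
  by rewrite exchange_big.
by move=> i _; rewrite (sinvE _ n.+1) ?mulr_sumr // ltnS leq_subr.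
Qed.

End Series.

Section ContinuedFraction.
Variables (R : comUnitRingType) (q t : R).

Definition up_weight h : R := t * qint q h.+1 * qint q h.+2.
Definition down_weight h : R := qint q h.+1 * qint q h.+2.

Lemma lam_split h : lam q t h.+1 = down_weight h * up_weight h.
Proof. by rewrite /lam /down_weight /up_weight; ring. Qed.

(** One piece of a path between consecutive visits to height [h]: a level step, or an up step, an
    excursion counted by [F], and a down step. *)
Definition cf_step (F : series R) (h : nat) : series R :=
  sadd (sscale (mu q h) (sshift (sone R))) (sscale (lam q t h.+1) (sshift (sshift F))).

Lemma cfrac_fix d h n : cfrac q t d.+1 h n =
  sone R n + smul (cf_step (cfrac q t d h.+1) h) (cfrac q t d.+1 h) n.
Proof.
rewrite [LHS]/= sinv_fix; last by rewrite /ssub /sadd /sscale /sone /=; ring.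
congr (_ + _); apply: eq_smull => m; rewrite /ssub /cf_step; ring.
Qed.

Lemma smul_cf_step F Y h n : smul (cf_step F h) Y n =
  mu q h * sshift Y n + lam q t h.+1 * sshift (sshift (smul F Y)) n.
Proof.
rewrite /cf_step smulDl !smul_scalel !smul_shiftl; congr (_ * _ + _ * _).
  by case: n => //= n; rewrite smul1.
by case: n => //= n; rewrite smul_shiftl.
Qed.

(* Generating series of the paths from 0 to h, cut after their last visits to the
   heights 0, 1, ..., h - 1; the continued fraction is truncated at height d. *)
Fixpoint passage (d h : nat) : series R :=
  if h is h'.+1 then
    sscale (up_weight h') (sshift (smul (cfrac q t (d - h) h) (passage d h')))
  else cfrac q t d 0.

(** Unfold the [cfrac] factor at height [h]: its 1 yields the up step from [h.-1], [mu] the level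
    step, and [lam], split in two, turns the remaining factors into [passage d h.+1] followed by a
    down step. *)
Lemma passageS d h n : (h < d)%N -> passage d h n.+1 =
  mu q h * passage d h n + down_weight h * passage d h.+1 n
  + (if h is h'.+1 then up_weight h' * passage d h' n else 0).
Proof.
case: h => [|h] hd.
  rewrite addr0 [passage d 0]/= [passage d 1]/= /sscale.
  case: d hd => // d _; rewrite cfrac_fix smul_cf_step add0r subSS subn0 lam_split.
  by rewrite /=; ring.
have -> : passage d h.+1 n.+1 =
    up_weight h * smul (cfrac q t (d - h.+1) h.+1) (passage d h) n by [].
have -> : (d - h.+1 = (d - h.+2).+1)%N by lia.
rewrite (eq_smull _ _ (cfrac_fix _ _)) [smul _ _ _]smulDl.
rewrite smul1 -smulA smul_cf_step.
have e : (d - h.+1 = (d - h.+2).+1)%N by lia.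
set Z := smul (cfrac _ _ _ _) (passage d h).
have pE : passage d h.+1 =1 sscale (up_weight h) (sshift Z).
  by move=> m; rewrite /= e.
rewrite pE [passage d h.+2 n]/= {2}/sscale.
have -> : sshift (smul (cfrac q t (d - h.+2) h.+2) (passage d h.+1)) n =
  up_weight h * sshift (sshift (smul (cfrac q t (d - h.+2) h.+2) Z)) n.
  case: n => [|n] /=; first by rewrite mulr0.
  by rewrite (eq_smulr _ _ pE) smul_scaler smul_shiftr.
rewrite /sscale lam_split; ring.
Qed.

Lemma passage0 d h : (h < d)%N -> passage d h 0%N = (h == 0%N)%:R.
Proof.
case: h => [|h] hd; last by rewrite /= /sscale /= mulr0.
case: d hd => // d _; rewrite -[passage _ _]/(cfrac q t d.+1 0) cfrac_fix smul_cf_step /=.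
by rewrite /sone !mulr0 !addr0.
Qed.

(** Both sides obey the same recursion, which never increases [n + h]; hence the truncation at
    height [d] is not felt. *)
Lemma passage_motzkin d h n : (n + h < d)%N -> passage d h n = motzkin q t 1 n h.
Proof.
elim: n h => [|n IH] h hd; first by rewrite passage0.
rewrite passageS; last by lia.
rewrite [RHS]/= mul1r !IH; try lia.
congr (_ + _); case: h hd => // h hd.
by rewrite IH //; lia.
Qed.

End ContinuedFraction.

(** * Permutation sums as Motzkin polynomials *)

Lemma Wpoly_motzkin (R : comUnitRingType) (q t : R) n :
  Wpoly q t n = motzkin q t (1 + t) n 0.
Proof.
rewrite -[t in 1 + t]mulr1 -sum_perms_motzkin /Wpoly big_mkcond.
apply: eq_big_seq => s sp; rewrite expr1n mulr1 (art_pat312 sp) -exprnP.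
by case: ifP; rewrite ?mul1r ?mul0r ?mulr0.
Qed.

(** The last entry is followed by 0, so it is a double descent unless it is preceded by a smaller
    entry. *)
Lemma primaryE n s : s \in perms n.+1 ->
  primary s = inWstar s && (count (is_ddesc s) (iota 1 (size s)) == 0%N).
Proof.
move=> sp; rewrite /primary; congr (_ && _).
have -> : (count (is_ddesc s) (iota 1 (size s)) == 0%N) =
          all (fun i => ~~ is_ddesc s i) (iota 1 (size s)).
  by rewrite -leqn0 leqNgt -has_count -all_predC.
case: allP => //= nd; have := sp; rewrite mem_permutations => ps.
have sz : size s = n.+1 by rewrite (perm_size ps) size_iota.
have us : uniq (0%N :: s).
  by rewrite /= (perm_uniq ps) iota_uniq (perm_mem ps) mem_iota.
have pos : (0 < nth 0 s n)%N.
  by rewrite lt0n; apply: contraTneq us => <-; rewrite /= mem_nth ?sz.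
have := nd n.+1; rewrite mem_iota sz ltnS leqnn /= => /(_ isT).
rewrite /is_ddesc !entE /= (@nth_default _ _ _ n.+1) ?sz // pos andbT.
have := nth_uniq 0%N (s := 0%N :: s) (i := n) (j := n.+1).
rewrite /= sz !ltnS leqnn leqnSn => /(_ isT isT us).
by rewrite (ltn_eqF (ltnSn n)); case: ltngtP.
Qed.

(** At [z = 0] the power of [z] is the indicator of having no double descent, and ['X] marks the
    descents. *)
Lemma gamma_coef (R : comUnitRingType) (q : R) n j :
  gamma q n j = (motzkin q%:P 'X 1 n 0)`_j.
Proof.
have -> : motzkin q%:P 'X 1 n 0 = motzkin q%:P 'X (1 + 'X * 0) n 0 by rewrite mulr0 addr0.
rewrite -sum_perms_motzkin coef_sum /gamma big_mkcond.
apply: eq_big_seq => s sp; rewrite (art_pat312 sp) -exprnP (primaryE sp) expr0n.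
case: (inWstar s); last by rewrite !mul0r mulr0 coef0.
case: eqP => _; last by rewrite !mulr0 coef0.
rewrite mul1r mulr1 -rmorphXn coefCM coefXn /= eq_sym.
by case: eqP; rewrite ?mulr1 ?mulr0.
Qed.

Theorem mainTheorem2 (R : comUnitRingType) (q t : R) (hq : q \is a GRing.unit) :
  (forall n : nat, (1 <= n)%N ->
     Wpoly q t n =
     \sum_(j < (n./2).+1) gamma q n j * t ^+ j * (1 + t) ^+ (n - 2 * j)) /\
  (forall n : nat, exists H : nat, forall d : nat, (H <= d)%N ->
     gammaGF q t n = cfrac q t d 0 n).
Proof.
have half n : (n + 0 < 2 * n./2.+1)%N by have := odd_double_half n; lia.
split=> [n _|n].
  rewrite Wpoly_motzkin (motzkin_coef _ _ _ (half n)).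
  by apply: eq_bigr => j _; rewrite gamma_coef addn0.
(* A path of [n] steps from height 0 fits below every depth [d > n]. *)
exists n.+1 => d nd; have := @passage_motzkin _ q t d 0 n; rewrite addn0 => /(_ nd) /= ->.
rewrite /gammaGF; case: eqP => [-> //|_].
rewrite (motzkin_coef _ _ _ (half n)).
by apply: eq_bigr => j _; rewrite gamma_coef expr1n mulr1.
Qed.
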